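(* Let $G=G(r,z,t)$ be odd in $z$ near $(r,z)=(1,0)$ and nonnegative for $z>0$ (in the packet of scale $\lambda(t)>0$), and let $a(t)=\partial_zG(1,0,t)$. Assume the cone nondegeneracy condition: for fixed constants $0<m<M$, $0<\kappa<1$ and $0<c_0<C_0$, $$c_0a(t)y\le G(1-x,y,t)\le C_0a(t)y$$ on the cone $\mathcal K_{\kappa\lambda}=\{0<x<\kappa\lambda,\ mx<y<Mx\}$, $\lambda=\lambda(t)$. Assume also that the outer annular contribution to $\mathcal H_{\lambda}[G]$ (the contribution of $\mathcal P_\lambda^+\setminus\mathcal K_{\kappa\lambda}$) is controlled by (at most a fixed constant times) the contribution of the cone $\mathcal K_{\kappa\lambda}$. Then there are constants $c,C>0$ such that $$c\,\lambda(t)a(t)\le\mathcal H_{\lambda(t)}[G(t)]\le C\,\lambda(t)a(t).$$ Equivalently, $\mathcal H_{\lambda(t)}[G(t)]\sim A(t)$, where $A(t)=\lambda(t)a(t)$.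
   Context: $x=1-r$, $y=z$ are flattened coordinates near $(r,z)=(1,0)$. $\mathcal P_\lambda^+=\{0<x<\lambda,\ 0<y<\lambda\}$, $K_0(x,y)=\frac{xy}{(x^2+y^2)^2}$, and the local hyperbolic mass is $\mathcal H_\lambda[G]=\int_{\mathcal P_\lambda^+}K_0(x,y)G(1-x,y)\,dx\,dy$. The constants $c,C$ depend only on $m,M,\kappa,c_0,C_0$ and the constant in the outer-annular control. *)

(* Defs.v *)
From HB Require Import structures.
From mathcomp Require Import all_boot all_order all_algebra.
From mathcomp Require Import all_classical all_reals all_analysis.

Set Implicit Arguments.
Unset Strict Implicit.
Unset Printing Implicit Defensive.

Import Order.TTheory GRing.Theory Num.Theory.
Import numFieldNormedType.Exports.

Local Open Scope classical_set_scope.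
Local Open Scope ring_scope.

(* Points p : R * R are flattened coordinates (x, y) = (1 - r, z), whereas a
   field G takes its arguments in the order r, z. *)

Definition packet (R : realType) (lam : R) : set (R * R) :=
  [set p | 0 < p.1 < lam /\ 0 < p.2 < lam].

(* The cone of size s need not lie in the packet of size lam, even for
   s < lam, since M * s may exceed lam. *)
Definition cone (R : realType) (m M s : R) : set (R * R) :=
  [set p | 0 < p.1 < s /\ m * p.1 < p.2 < M * p.1].

Definition K0 (R : realType) (x y : R) : R := x * y / (x ^+ 2 + y ^+ 2) ^+ 2.

(* Extended-real valued, so that finiteness of the mass is not presupposed. *)
Definition contribution (R : realType) (D : set (R * R)) (G : R -> R -> R) :
    \bar R :=
  (\int[@lebesgue_measure R \x @lebesgue_measure R]_(p in D)
     (K0 p.1 p.2 * G (1 - p.1) p.2)%:E)%E.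

Definition hyperbolic_mass (R : realType) (lam : R) (G : R -> R -> R) : \bar R :=
  contribution (packet lam) G.

Definition axial_slope (R : realType) (G : R -> R -> R) : R := derive1 (G 1) 0.

(* Oddness in z on a one-sided neighbourhood, inside r <= 1, of (1, 0). *)
Definition odd_near (R : realType) (G : R -> R -> R) : Prop :=
  \forall q \near within [set q : R * R | q.1 <= 1] (nbhs ((1, 0) : R * R)),
    G q.1 (- q.2) = - G q.1 q.2.

(* Main.v *)
Require Import Defs.
From HB Require Import structures.
From mathcomp Require Import all_boot all_order all_algebra.
From mathcomp Require Import all_classical all_reals all_analysis.
From mathcomp Require Import measurable_realfun ring.

Set Implicit Arguments.
Unset Strict Implicit.
Unset Printing Implicit Defensive.

Import Order.TTheory GRing.Theory Num.Theory.
Import numFieldNormedType.Exports.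

Local Open Scope classical_set_scope.
Local Open Scope ring_scope.

(** The reason for the estimate is that, on the cone [m x < y < M x], the
    weighted kernel [K0 x y * y] is comparable to [1 / x]: [K0] is homogeneous
    of degree -2 and [y] is comparable to [x].  The upper comparison
    [K0_mulr_le] is the inequality between arithmetic and geometric means; the
    lower one, [K0_mulr_ge], uses both sides of the cone.

    The function [1 / x] has an exact integral over the cone of size [s]: the
    slice at [x] is an interval of length [(M - m) x], so Tonelli's theorem
    gives [s (M - m)] ([integral_cone_inv]).  Linear growth in the size [s] of
    the cone is where the factor [lam] in the theorem comes from.

    Since [c0 a y <= G <= C0 a y] on the cone, the part of the mass carried by
    the cone is therefore comparable to [lam a].  For the upper bound the
    packet constraint is dropped and the whole cone of size [kappa lam] is used
    ([cone_contribution_le]).  For the lower bound the cone may stick out of the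
    packet, so it is first shortened to size [q lam] with
    [q = min (1, kappa, 1 / M)], which makes it fit ([cone_contribution_ge]).

    Finally the mass splits into its cone part and its outer part
    ([hyperbolic_mass_split]): the outer part is nonnegative, which preserves
    the lower bound, and at most [Cout] times the cone part, which costs a
    factor [1 + Cout] in the upper bound. *)

(** * Measurability *)

(** On nonnegative arguments the inverse is the real power of exponent -1,
    zero included, and real powers are measurable on the whole line. *)
Lemma measurable_fun_inv_ge0 d (T : measurableType d) (R : realType)
    (D : set T) (f : T -> R) :
  measurable D -> (forall x, D x -> 0 <= f x) -> measurable_fun D f ->
  measurable_fun D (fun x => (f x)^-1).
Proof.
move=> mD f0 mf; apply: (@eq_measurable_fun _ _ _ _ _ (fun x => f x `^ (-1))).
  by move=> x /set_mem Dx; rewrite powR_inv1// f0.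
by apply: (measurableT_comp (measurable_powR (-1))).
Qed.

Lemma measurable_lt_fun d (T : measurableType d) (R : realType) (f g : T -> R) :
  measurable_fun setT f -> measurable_fun setT g ->
  measurable [set x | f x < g x].
Proof.
move=> mf mg; have := measurable_fun_ltr mf mg measurableT (Y := [set true]).
by rewrite setTI; apply.
Qed.

Lemma measurable_packet (R : realType) (lam : R) : measurable (packet lam).
Proof.
rewrite (_ : packet lam = `]0, lam[ `*` `]0, lam[)//.
exact: measurableX.
Qed.

Lemma measurable_cone (R : realType) (m M s : R) : measurable (cone m M s).
Proof.
have m1 : measurable_fun [set: R * R] (fun p : R * R => p.1).
  exact: measurable_fst.
have m2 : measurable_fun [set: R * R] (fun p : R * R => p.2).
  exact: measurable_snd.
rewrite (_ : cone m M s =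
  ([set p | 0 < p.1] `&` [set p | p.1 < s]) `&`
  ([set p | m * p.1 < p.2] `&` [set p | p.2 < M * p.1])).
  by do !apply: measurableI; apply: measurable_lt_fun => //;
    apply: measurable_funM.
apply/seteqP; split=> p /=; first by move=> [/andP[-> ->] /andP[-> ->]].
by rewrite /cone/= => -[[-> ->] [-> ->]].
Qed.

Lemma measurable_K0_packet (R : realType) (lam : R) :
  measurable_fun (packet lam) (fun p : R * R => K0 p.1 p.2).
Proof.
have m1 : measurable_fun (packet lam) (fun p : R * R => p.1).
  exact: measurable_funTS measurable_fst.
have m2 : measurable_fun (packet lam) (fun p : R * R => p.2).
  exact: measurable_funTS measurable_snd.
apply: measurable_funM; first exact: measurable_funM.
apply: measurable_fun_inv_ge0; first exact: measurable_packet.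
  by move=> p _; rewrite sqr_ge0.
by apply: measurable_funX; apply: measurable_funD; apply: measurable_funX.
Qed.

(** * The kernel on the cone *)

Lemma K0_ge0 (R : realType) (x y : R) : 0 <= x -> 0 <= y -> 0 <= K0 x y.
Proof. by move=> x0 y0; rewrite /K0 divr_ge0 ?sqr_ge0// mulr_ge0. Qed.

(** After clearing denominators this is the inequality of means for [x ^ 2] and
    [y ^ 2], that is, [4 x^2 y^2 <= (x^2 + y^2)^2]. *)
Lemma K0_mulr_le (R : realType) (x y : R) : 0 < x ->
  K0 x y * y <= 4^-1 * x^-1.
Proof.
move=> x0; have s0 : 0 < x ^+ 2 + y ^+ 2.
  by rewrite ltr_pwDl ?sqr_ge0// exprn_gt0.
rewrite /K0 mulrAC ler_pdivrMr ?exprn_gt0// -invfM.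
rewrite [leRHS]mulrC ler_pdivlMr; last by rewrite mulr_gt0.
rewrite (_ : _ * (4 * x) = 4 * (x ^+ 2 * y ^+ 2)); last by ring.
rewrite -subr_ge0 (_ : _ - _ = (x ^+ 2 - y ^+ 2) ^+ 2) ?sqr_ge0//; ring.
Qed.

(** The lower edge of the cone gives [m x <= y] in the numerator, the upper edge
    gives [x^2 + y^2 <= (1 + M^2) x^2] in the denominator.  The form [k / x] is
    chosen so that the same integral serves for both bounds of the mass. *)
Lemma K0_mulr_ge (R : realType) (m M x y : R) : 0 < m -> 0 < x ->
  m * x < y < M * x -> m ^+ 2 / (1 + M ^+ 2) ^+ 2 * x^-1 <= K0 x y * y.
Proof.
move=> m0 x0 /andP[mxy yMx].
have y0 : 0 < y by rewrite (lt_trans _ mxy) ?mulr_gt0.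
have M1 : 0 < 1 + M ^+ 2 by rewrite ltr_pwDl ?sqr_ge0.
rewrite -mulrA -invfM /K0 [leRHS]mulrAC ler_pdivrMr ?mulr_gt0 ?exprn_gt0//.
rewrite [leRHS]mulrAC ler_pdivlMr ?exprn_gt0 ?addr_gt0 ?exprn_gt0//.
(* Both sides are squares, so it suffices to compare their roots. *)
have -> : x * y * y * ((1 + M ^+ 2) ^+ 2 * x) =
  y ^+ 2 * ((1 + M ^+ 2) * x) ^+ 2 by ring.
have -> : m ^+ 2 * (x ^+ 2 + y ^+ 2) ^+ 2 =
  (m * (x ^+ 2 + y ^+ 2)) ^+ 2 by ring.
rewrite -exprMn; apply: lerXn2r.
- by rewrite nnegrE mulr_ge0 ?addr_ge0 ?sqr_ge0// ltW.
- by rewrite nnegrE ltW// !mulr_gt0.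
have xy : x ^+ 2 + y ^+ 2 <= (1 + M ^+ 2) * x ^+ 2.
  by rewrite mulrDl mul1r lerD2l -exprMn ler_sqr ?nnegrE ltW// (lt_trans y0).
apply: (le_trans (ler_wpM2l (ltW m0) xy)).
rewrite (_ : m * _ = m * x * ((1 + M ^+ 2) * x)); last by ring.
by rewrite ler_wpM2r// ltW// mulr_gt0.
Qed.

Lemma cone_inv_ge0 (R : realType) (m M s : R) p :
  cone m M s p -> (0 <= (p.1^-1)%:E)%E.
Proof. by move=> [/andP[x0 _] _]; rewrite lee_fin invr_ge0 ltW. Qed.

Lemma measurable_cone_inv (R : realType) (m M s : R) :
  measurable_fun (cone m M s) (fun p : R * R => (p.1^-1)%:E).
Proof.
apply/measurable_EFinP; apply: measurable_fun_inv_ge0.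
- exact: measurable_cone.
- by move=> p [/andP[/ltW]].
- exact: measurable_funTS measurable_fst.
Qed.

(** The slice of the cone at [x] has length [(M - m) x], which cancels the
    singularity of [1 / x]: the inner integral is the constant [M - m]. *)
Lemma integral_cone_inv (R : realType) (m M s : R) : 0 <= s -> m <= M ->
  (\int[@lebesgue_measure R \x @lebesgue_measure R]_(p in cone m M s)
     (p.1^-1)%:E = (s * (M - m))%:E)%E.
Proof.
move=> s0 mM.
rewrite integral_mkcond fubini_tonelli1; last 2 first.
- apply/(measurable_restrictT _ _).1; first exact: measurable_cone.
  exact: measurable_cone_inv.
- by apply: erestrict_ge0 => p; exact: cone_inv_ge0.
transitivity (\int[@lebesgue_measure R]_(x in `]0%R, s[) (M - m)%:E)%E.
  rewrite [RHS]integral_mkcond; apply: eq_integral => x _; rewrite /fubini_F.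
  rewrite [RHS]patchE mem_setE in_itv/=.
  have -> : (fun y => ((fun p : R * R => p.1^-1%:E) \_ (cone m M s)) (x, y)) =
      (if 0 < x < s then (cst (x^-1)%:E) \_ `](m * x)%R, (M * x)%R[
       else cst 0%E).
    apply/funext => y; rewrite patchE; case: ifPn.
      rewrite inE => -[/= -> xy]; rewrite patchE ifT//.
      by rewrite mem_setE in_itv/=.
    move=> /negP; rewrite inE /cone/= => nc; case: ifPn => // xs.
    rewrite patchE ifF//; apply/negP; rewrite mem_setE in_itv/= => xy.
    exact: nc.
  case: ifPn => [/andP[x0 xs]|_]; last exact: integral0.
  rewrite -integral_mkcond integral_cst//= lebesgue_measure_itv/= lte_fin.
  rewrite ltr_pM2r//; case: ltgtP mM => // [mM _|-> _].
    by rewrite -EFinB -EFinM -mulrBl mulrCA mulVf ?mulr1// gt_eqF.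
  by rewrite subrr mule0.
rewrite integral_cst//= lebesgue_measure_itv/= lte_fin.
case: ltgtP s0 => // [s0 _|<- _]; last by rewrite mule0 mul0r.
by rewrite oppr0 adde0 -EFinM mulrC.
Qed.

(** * Contributions to the mass *)

Section contribution.
Variables (R : realType) (lam : R) (G : R -> R -> R).
Hypothesis G_ge0 : forall x y, packet lam (x, y) -> 0 <= G (1 - x) y.
Hypothesis mG : measurable_fun (packet lam) (fun p : R * R => G (1 - p.1) p.2).

Let f (p : R * R) : \bar R := (K0 p.1 p.2 * G (1 - p.1) p.2)%:E.

Lemma integrand_ge0 p : packet lam p -> (0 <= f p)%E.
Proof.
case: p => x y pxy; have [/andP[/ltW x0 _] /andP[/ltW y0 _]] := pxy.
by rewrite lee_fin mulr_ge0 ?K0_ge0// G_ge0.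
Qed.

Lemma measurable_integrand : measurable_fun (packet lam) f.
Proof.
by apply/measurable_EFinP/measurable_funM => //; exact: measurable_K0_packet.
Qed.

Lemma hyperbolic_mass_split (m M s : R) :
  (hyperbolic_mass lam G = contribution (packet lam `&` cone m M s) G +
                           contribution (packet lam `\` cone m M s) G)%E.
Proof.
rewrite /hyperbolic_mass /contribution.
rewrite -[X in integral _ X](setUIDK _ (cone m M s)).
rewrite ge0_integral_setU//.
- apply: measurableI; [exact: measurable_packet|exact: measurable_cone].
- apply: measurableD; [exact: measurable_packet|exact: measurable_cone].
- by rewrite setUIDK; exact: measurable_integrand.
- by rewrite setUIDK; exact: integrand_ge0.
- by rewrite disj_set2E setDE setIACA setICr setI0.
Qed.

Lemma contribution_ge0 (D : set (R * R)) :
  D `<=` packet lam -> (0 <= contribution D G)%E.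
Proof. by move=> DP; apply: integral_ge0 => p /DP; exact: integrand_ge0. Qed.

(** The integrand is at most [A / (4 x)], a bound that is integrable over the
    whole cone, so that it does not matter how the packet cuts the cone. *)
Lemma cone_contribution_le (m M s A : R) : 0 <= s -> m <= M -> 0 <= A ->
  (forall x y, cone m M s (x, y) -> G (1 - x) y <= A * y) ->
  (contribution (packet lam `&` cone m M s) G <=
    (A * 4^-1 * (s * (M - m)))%:E)%E.
Proof.
move=> s0 mM A0 GA; have A4 : 0 <= A * 4^-1 by rewrite divr_ge0.
have mC := measurable_cone m M s.
have mPC : measurable (packet lam `&` cone m M s).
  by apply: measurableI => //; exact: measurable_packet.
have minv := @measurable_cone_inv R m M s.
have inv0 := @cone_inv_ge0 R m M s.
rewrite EFinM -integral_cone_inv// -ge0_integralZl_EFin//.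
apply: (@le_trans _ _ (\int[@lebesgue_measure R \x @lebesgue_measure R]_(p in
    packet lam `&` cone m M s) ((A * 4^-1)%:E * (p.1^-1)%:E))%E).
  apply: ge0_le_integral => //.
  + by move=> p [? _]; exact: integrand_ge0.
  + apply: measurable_funS measurable_integrand => //.
    exact: measurable_packet.
  + apply: measurable_funeM; exact: measurable_funS minv.
  + move=> [x y] [[/andP[x0 _] /andP[y0 _]] /GA Gxy] /=; rewrite -EFinM lee_fin.
    apply: (@le_trans _ _ (K0 x y * (A * y))).
      by rewrite ler_wpM2l// K0_ge0// ltW.
    by rewrite mulrCA -[leRHS]mulrA ler_wpM2l// K0_mulr_le.
apply: ge0_subset_integral => //.
- exact: measurable_funeM.
- by move=> p /inv0 ?; rewrite mule_ge0.
Qed.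

(** The parameter [q] is the size of a shorter cone: [M * q <= lam] and
    [q <= lam] place it inside the packet, [q <= s] inside the given cone. *)
Lemma cone_contribution_ge (m M s q B : R) :
  0 < m -> m <= M -> 0 <= q -> q <= s -> M * q <= lam -> q <= lam -> 0 <= B ->
  (forall x y, cone m M s (x, y) -> B * y <= G (1 - x) y) ->
  ((B * (m ^+ 2 / (1 + M ^+ 2) ^+ 2) * (q * (M - m)))%:E <=
    contribution (packet lam `&` cone m M s) G)%E.
Proof.
move=> m0 mM q0 qs Mq ql B0 GB.
have M0 : 0 < M by exact: lt_le_trans mM.
have k0 : 0 <= B * (m ^+ 2 / (1 + M ^+ 2) ^+ 2).
  by rewrite mulr_ge0 ?divr_ge0 ?sqr_ge0.
have mC := measurable_cone m M q.
have qP : cone m M q `<=` packet lam.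
  move=> [x y] [/= /andP[x0 xq] /andP[mxy yMx]]; split=> /=.
    by rewrite x0 (lt_le_trans xq).
  rewrite (lt_trans _ mxy) ?mulr_gt0// (lt_le_trans yMx)//.
  by rewrite (le_trans _ Mq)// ler_pM2l// ltW.
have qs' : cone m M q `<=` cone m M s.
  by move=> p [/andP[x0 xq] yM]; split=> //; rewrite x0 (lt_le_trans xq).
have mfP := measurable_funS (measurable_packet lam) _ measurable_integrand.
rewrite EFinM -integral_cone_inv// -ge0_integralZl_EFin//; last 2 first.
- exact: cone_inv_ge0.
- exact: measurable_cone_inv.
apply: (@le_trans _ _ (contribution (cone m M q) G)).
  apply: ge0_le_integral => //.
  + by move=> p /cone_inv_ge0; exact: mule_ge0.
  + by apply: measurable_funeM; apply: measurable_cone_inv.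
  + exact: mfP.
  + move=> [x y] pq; have [/andP[/= x0 xq] /= xy] := pq.
    have [_ /andP[/= y0 _]] := qP _ pq.
    rewrite -EFinM lee_fin -mulrA.
    apply: (le_trans (ler_wpM2l B0 (K0_mulr_ge m0 x0 xy))).
    rewrite mulrCA; apply: ler_wpM2l; first by rewrite K0_ge0// ltW.
    exact/GB/qs'.
apply: ge0_subset_integral => //.
- by apply: measurableI; [exact: measurable_packet|exact: measurable_cone].
- exact: mfP.
- by move=> p [? _]; exact: integrand_ge0.
- by move=> p pq; split; [exact: qP|exact: qs'].
Qed.

End contribution.

(** * The two-sided estimate *)

Theorem theorem6p1 (R : realType) (m M kappa c0 C0 Cout : R)
    (m_gt0 : 0 < m) (m_lt_M : m < M)
    (kappa_gt0 : 0 < kappa) (kappa_lt1 : kappa < 1)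
    (c0_gt0 : 0 < c0) (c0_lt_C0 : c0 < C0)
    (Cout_ge0 : 0 <= Cout) :
  exists c C : R, 0 < c /\ 0 < C /\
    forall (I : set R) (lam : R -> R) (G : R -> R -> R -> R),
      let Gt (t : R) : R -> R -> R := fun r z => G r z t in
      let a (t : R) : R := axial_slope (Gt t) in
      (forall t, I t -> 0 < lam t) ->
      (forall t, I t -> odd_near (Gt t)) ->
      (forall t, I t -> forall x y, packet (lam t) (x, y) ->
        0 <= G (1 - x) y t) ->
      (forall t, I t -> measurable_fun (packet (lam t))
        (fun p : R * R => G (1 - p.1) p.2 t)) ->
      (forall t, I t -> derivable (Gt t 1) 0 1) ->
      (forall t, I t -> forall x y, cone m M (kappa * lam t) (x, y) ->
        c0 * a t * y <= G (1 - x) y t <= C0 * a t * y) ->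
      (forall t, I t ->
        (contribution (packet (lam t) `\` cone m M (kappa * lam t)) (Gt t)
         <= Cout%:E *
            contribution (packet (lam t) `&` cone m M (kappa * lam t)) (Gt t))%E) ->
      forall t, I t ->
        ((c * (lam t * a t))%:E <= hyperbolic_mass (lam t) (Gt t))%E /\
        (hyperbolic_mass (lam t) (Gt t) <= (C * (lam t * a t))%:E)%E.
Proof.
have M_gt0 : 0 < M := lt_trans m_gt0 m_lt_M.
have Mm_gt0 : 0 < M - m by rewrite subr_gt0.
(* A cone of relative size [q] fits into both the packet and the given cone. *)
set q := Num.min 1 (Num.min kappa M^-1).
have q_gt0 : 0 < q by rewrite !lt_min ltr01 kappa_gt0 invr_gt0.
have [q_le1 q_lek q_leM] : [/\ q <= 1, q <= kappa & M * q <= 1].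
  rewrite mulrC -ler_pdivlMr// div1r; apply/and3P.
  by rewrite -!le_min.
set k := m ^+ 2 / (1 + M ^+ 2) ^+ 2.
have k_gt0 : 0 < k.
  by rewrite divr_gt0 ?exprn_gt0// ltr_pwDl// sqr_ge0.
exists (c0 * k * (q * (M - m))), ((1 + Cout) * (C0 * 4^-1 * (kappa * (M - m)))).
split; first exact: mulr_gt0 (mulr_gt0 c0_gt0 k_gt0) (mulr_gt0 q_gt0 Mm_gt0).
split.
  have C0_gt0 := lt_trans c0_gt0 c0_lt_C0.
  apply: mulr_gt0; first by rewrite ltr_wpDr.
  by do !apply: mulr_gt0.
move=> I lam G Gt a lam_gt0 _ G_ge0 mG _ coneG outer t It.
have l0 := lam_gt0 t It.
(* The two bounds on [G] at a point of the cone force [c0 * a <= C0 * a]. *)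
have a_ge0 : 0 <= a t.
  pose x := kappa * lam t / 2; pose y := (m + M) / 2 * x.
  have x0 : 0 < x by rewrite divr_gt0// mulr_gt0.
  have xC : cone m M (kappa * lam t) (x, y).
    split=> /=.
      by rewrite x0 ltr_pdivrMr// mulr_natr mulr2n ltrDl mulr_gt0.
    by rewrite /y !ltr_pM2r// !(midf_lt m_lt_M).
  have /andP[h1 h2] := coneG t It x y xC.
  have y0 : 0 < y by rewrite mulr_gt0// divr_gt0// addr_gt0.
  have := le_trans h1 h2; rewrite ler_pM2r// -subr_ge0 -mulrBl.
  by rewrite pmulr_rge0// subr_gt0.
have Cpos := @contribution_ge0 R (lam t) (Gt t) (G_ge0 t It).
have split_mass := @hyperbolic_mass_split R (lam t) (Gt t) (G_ge0 t It)
  (mG t It) m M (kappa * lam t).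
have upper : (contribution (packet (lam t) `&` cone m M (kappa * lam t)) (Gt t)
    <= (C0 * a t * 4^-1 * (kappa * lam t * (M - m)))%:E)%E.
  apply: (@cone_contribution_le R (lam t) (Gt t) (G_ge0 t It) (mG t It)) => //.
  - by rewrite mulr_ge0 ?ltW.
  - exact: ltW.
  - by rewrite mulr_ge0// ltW// (lt_trans c0_gt0).
  - by move=> x y /(coneG t It) /andP[].
have lower : ((c0 * a t * k * (q * lam t * (M - m)))%:E
    <= contribution (packet (lam t) `&` cone m M (kappa * lam t)) (Gt t))%E.
  apply: (@cone_contribution_ge R (lam t) (Gt t) (G_ge0 t It) (mG t It)) => //.
  - exact: ltW.
  - by rewrite mulr_ge0 ?ltW.
  - by rewrite ler_pM2r.
  - by rewrite mulrA ger_pMl.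
  - by rewrite ger_pMl.
  - by rewrite mulr_ge0// ltW.
  - by move=> x y /(coneG t It) /andP[].
rewrite split_mass; split.
  apply: (@le_trans _ _ _ _ _ _ (leeDl _ (Cpos _ (@subDsetl _ _ _)))).
  apply: le_trans lower; rewrite lee_fin le_eqVlt; apply/orP; left; apply/eqP.
  by ring.
apply: (le_trans (leeD2l _ (outer t It))).
rewrite -[X in (X + _)%E]mul1e -ge0_muleDl//.
apply: (@le_trans _ _ ((1 + Cout)%:E *
    (C0 * a t * 4^-1 * (kappa * lam t * (M - m)))%:E)%E).
  by apply: lee_wpmul2l => //; rewrite lee_fin addr_ge0.
rewrite -EFinM lee_fin le_eqVlt; apply/orP; left; apply/eqP.
by ring.
Qed.
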